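(* Let $a$ be a nonzero integer with $3\mid a$, and let $n$ be a positive integer with $n\ge 2$. Then $$E_{2n,a}\equiv \frac{2a}{3a-2}+9a^2n^3+9a^2n^2-3a^2n\pmod{3^{\mathrm{ord}_3 n+5}}.$$
   Context: For a real number $a$, the sequence $\{E_{n,a}\}$ is defined by $E_{0,a}=1$ and $E_{n,a}=-a\sum_{k=1}^{\lfloor n/2\rfloor}\binom{n}{2k}E_{n-2k,a}$ for $n\ge 1$. For a prime $p$ and a positive integer $n$, $\mathrm{ord}_p n$ denotes the largest nonnegative integer $\alpha$ with $p^\alpha\mid n$. A congruence between rational numbers whose denominators are coprime to $p$ is understood modulo the given power of $p$ in the ring of such rationals (here $3a-2$ is coprime to $3$). *)

(* Defs.v *)
From mathcomp Require Import all_boot all_order all_algebra.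

Set Implicit Arguments.
Unset Strict Implicit.
Unset Printing Implicit Defensive.

Import GRing.Theory.
Local Open Scope ring_scope.

(* The list [:: E_{0,a}; ...; E_{n,a}]. The whole prefix is carried along
   because the recurrence for E_{n,a} uses all the E_{n-2k,a}. *)
Fixpoint Eprefix (R : nzRingType) (a : R) (n : nat) : seq R :=
  if n is m.+1 then
    let s := Eprefix a m in
    rcons s (- a * \sum_(1 <= k < (n./2).+1)
                     'C(n, 2 * k)%:R * s`_(n - 2 * k))
  else [:: 1].

Definition Eseq (R : nzRingType) (a : R) (n : nat) : R := (Eprefix a n)`_n.

Lemma size_Eprefix (R : nzRingType) (a : R) n : size (Eprefix a n) = n.+1.
Proof. by elim: n => //= n IHn; rewrite size_rcons IHn. Qed.

Lemma nth_Eprefix (R : nzRingType) (a : R) n i :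
  (i <= n)%N -> (Eprefix a n)`_i = Eseq a i.
Proof.
elim: n => [|n IHn]; first by rewrite leqn0 => /eqP->.
rewrite leq_eqVlt => /predU1P[-> //|lt_i_n1].
by rewrite /= nth_rcons size_Eprefix lt_i_n1 IHn.
Qed.

Lemma Eseq0 (R : nzRingType) (a : R) : Eseq a 0 = 1.
Proof. by []. Qed.

Lemma Eseq_rec (R : nzRingType) (a : R) n : (1 <= n)%N ->
  Eseq a n = - a * \sum_(1 <= k < (n./2).+1)
                     'C(n, 2 * k)%:R * Eseq a (n - 2 * k).
Proof.
case: n => // n _.
rewrite {1}/Eseq /= nth_rcons size_Eprefix ltnn eqxx; congr (_ * _).
apply: eq_big_nat => k /andP[k_gt0 _]; rewrite nth_Eprefix //.
by rewrite leq_subLR -addn1 addnC leq_add2r muln_gt0.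
Qed.

Definition p_integral (p : nat) (x : rat) : bool := coprime p `|denq x|.

(* x = y (mod p^k) in the ring of the rationals with denominator prime to p. *)
Definition rat_congr (p k : nat) (x y : rat) : Prop :=
  [/\ p_integral p x, p_integral p y &
      exists2 z : rat, p_integral p z & x - y = p%:R ^+ k * z].

(* Main.v *)
(* Let delta f x = f (x + 1) - 2 f x + f (x - 1) and
   L f = ((1 + (a/2) delta)^-1 f) 0. Half the central difference of x^(2n) is
   the sum of the C(2n, 2k) x^(2n - 2k) for k >= 1, so L (x^(2n)) obeys the
   recurrence of E_{2n,a} and equals it. As 3 | a, the geometric series for L
   converges 3-adically. Split x^(2n) = chi + g, with chi the indicator of the
   integers prime to 3. Since delta chi = 2 - 3 chi, L chi = 2a / (3a - 2)
   exactly. All values of g are divisible by 3^(ord n + 1), g vanishes at 0, 1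
   and -1, and (delta^3 g) 0 = 2 g 3 - 12 g 2 is divisible by 3^(ord n + 2).
   Hence modulo 3^(ord n + 5) only the term
   (a/2)^2 (delta^2 g) 0 = a^2 (4^n - 1) / 2 of L g survives, and
   4^n - 1 = 18 n^3 + 18 n^2 - 6 n modulo 3^(ord n + 3). *)
Require Import Defs.
From mathcomp Require Import all_boot all_order all_algebra.
From mathcomp Require Import ring zify.

Import GRing.Theory.
Local Open Scope ring_scope.

(** * Second differences and the truncated resolvent *)

Definition delta2 (f : int -> int) (x : int) : int :=
  f (x + 1) - 2 * f x + f (x - 1).

Lemma iter_delta2_sum (I : Type) (r : seq I) (c : I -> int)
    (g : I -> int -> int) (f : int -> int) (j : nat) :
  (forall x, f x = \sum_(i <- r) c i * g i x) ->
  forall x, iter j delta2 f x = \sum_(i <- r) c i * iter j delta2 (g i) x.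
Proof.
move=> f_sum; elim: j => [//|j IHj] x; rewrite iterS /delta2 !IHj.
rewrite mulr_sumr -sumrN -!big_split /=; apply: eq_bigr => i _.
by rewrite /delta2; ring.
Qed.

Lemma dvdz_iter_delta2 (d : int) (f : int -> int) (j : nat) :
  (forall x, d %| f x)%Z -> forall x, (d %| iter j delta2 f x)%Z.
Proof.
move=> d_f; elim: j => [//|j IHj] x; rewrite iterS /delta2.
by rewrite rpredD ?rpredB ?dvdz_mull.
Qed.

(** Indices are paired so that, in (x + 1)^(2n) + (x - 1)^(2n), the odd terms cancel and the even
    ones double. *)
Lemma sum_ord_doubleS (V : nmodType) (F : nat -> V) (m : nat) :
  \sum_(i < (2 * m).+1) F i =
  F 0 + \sum_(1 <= k < m.+1) (F (2 * k).-1 + F (2 * k)%N).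
Proof.
elim: m => [|m IHm]; first by rewrite big_ord1 big_nil addr0.
have double_S : (2 * m.+1 = (2 * m).+2)%N by rewrite mulnS.
rewrite double_S 2!big_ord_recr /= IHm [in RHS]big_nat_recr // double_S.
by rewrite /= !addrA.
Qed.

Lemma delta2_exp_even (n : nat) (x : int) :
  delta2 (fun y => y ^+ (2 * n)) x =
  \sum_(1 <= k < n.+1) (2 * 'C(2 * n, 2 * k)%:R) * x ^+ (2 * (n - k)).
Proof.
rewrite /delta2 !exprDn.
rewrite (sum_ord_doubleS _
  (fun i => (x ^+ (2 * n - i) * 1 ^+ i) *+ 'C(2 * n, i))).
rewrite (sum_ord_doubleS _
  (fun i => (x ^+ (2 * n - i) * (-1) ^+ i) *+ 'C(2 * n, i))).
rewrite subn0 bin0 !expr0 mulr1 mulr1n.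
set S1 := \sum_(1 <= k < _) _; set S2 := \sum_(1 <= k < _) _.
have -> : x ^+ (2 * n) + S1 - 2 * x ^+ (2 * n) + (x ^+ (2 * n) + S2) = S1 + S2.
  by ring.
rewrite -big_split /=; apply: eq_big_nat => k /andP[k_gt0 _].
have sgn_even : (-1 : int) ^+ (2 * k) = 1.
  by rewrite -signr_odd mul2n odd_double.
have sgn_odd : (-1 : int) ^+ (2 * k).-1 = -1.
  by rewrite -signr_odd; have -> : odd (2 * k).-1 by lia.
rewrite sgn_even sgn_odd !expr1n !mulr1 mulnBr.
rewrite mulrN1 mulNrn addrACA subrr add0r.
rewrite -(mulr_natl _ 'C(2 * n, 2 * k)); ring.
Qed.

(* The value at 0 of [(1 + h delta2)^-1 f], with the geometric series cut at
   [K] terms. *)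
Definition resolvent0 (h : int) (K : nat) (f : int -> int) : int :=
  \sum_(j < K) (- h) ^+ j * iter j delta2 f 0.

Lemma resolvent0_sum (h : int) (K : nat) (I : Type) (r : seq I) (c : I -> int)
    (g : I -> int -> int) (f : int -> int) :
  (forall x, f x = \sum_(i <- r) c i * g i x) ->
  resolvent0 h K f = \sum_(i <- r) c i * resolvent0 h K (g i).
Proof.
move=> f_sum; rewrite /resolvent0.
under [RHS]eq_bigr => i _ do rewrite mulr_sumr.
rewrite exchange_big /=; apply: eq_bigr => j _.
rewrite (iter_delta2_sum I r c g) // mulr_sumr.
by apply: eq_bigr => i _; ring.
Qed.

Lemma resolvent0_lin (h : int) (K : nat) (u v : int) (g1 g2 f : int -> int) :
  (forall x, f x = u * g1 x + v * g2 x) ->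
  resolvent0 h K f = u * resolvent0 h K g1 + v * resolvent0 h K g2.
Proof.
move=> f_lin.
rewrite (resolvent0_sum h K _ [:: (u, g1); (v, g2)] fst snd).
  by rewrite !big_cons big_nil addr0.
by move=> x; rewrite !big_cons big_nil addr0.
Qed.

Lemma resolvent0_delta2 (h : int) (K : nat) (f : int -> int) :
  resolvent0 h K f + h * resolvent0 h K (delta2 f) =
  f 0 - (- h) ^+ K * iter K delta2 f 0.
Proof.
rewrite /resolvent0; elim: K => [|k IHk].
  by rewrite !big_ord0 expr0 mul1r mulr0 addr0 subrr.
rewrite !big_ord_recr /= mulrDr addrACA IHk exprS -iterSr /=.
by ring.
Qed.

Lemma resolvent0_eqmod (h : int) (K : nat) (f : int -> int) : (3 %| h)%Z ->
  (3 ^+ K %| resolvent0 h K f + h * resolvent0 h K (delta2 f) - f 0)%Z.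
Proof.
move=> h3; rewrite resolvent0_delta2 addrAC subrr sub0r rpredN dvdz_mulr //.
by rewrite dvdz_exp2r // rpredN.
Qed.

(** Here [h] plays the role of a / 2 modulo 3^K, so both sides obey the same recurrence modulo
    3^K. *)
Lemma Eseq_resolvent0 (h : int) (K : nat) (a : int) (n : nat) :
  (3 %| h)%Z -> (3 ^+ K %| 2 * h - a)%Z ->
  (3 ^+ K %| Eseq a (2 * n) - resolvent0 h K (fun x => x ^+ (2 * n)))%Z.
Proof.
move=> h3 ha; elim/ltn_ind: n => n IHn.
have := resolvent0_eqmod h K (fun x => x ^+ (2 * n)) h3.
case: (posnP n) => [->|n_gt0].
  (* The second difference of a constant is 0; written as an empty sum, it has resolvent 0 by
     linearity. *)
  rewrite (resolvent0_sum _ _ 'I_0 [::] (fun=> 0) (fun=> id) (delta2 _)).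
    by rewrite big_nil mulr0 addr0 Eseq0 -rpredN opprB.
  by move=> x; rewrite /delta2 big_nil !expr0.
rewrite (resolvent0_sum _ _ _ _ _ _ _ (delta2_exp_even n)).
rewrite expr0n muln_eq0 /= gtn_eqF // subr0 => L_rec.
rewrite Eseq_rec ?muln_gt0 //= mul2n doubleK -mul2n.
set L := resolvent0 h K.
rewrite -(rpredDr _ L_rec) -/L.
set S := \sum_(1 <= k < _) _ * L _.
have -> : S = 2 * \sum_(1 <= k < n.+1)
    'C(2 * n, 2 * k)%:R * L (fun x => x ^+ (2 * (n - k))).
  by rewrite /S mulr_sumr; apply: eq_bigr => k _; rewrite mulrA.
set S1 := \sum_(1 <= k < _) _; set S2 := \sum_(1 <= k < _) _.
have -> : - a * S1 - L (fun x => x ^+ (2 * n)) +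
    (L (fun x => x ^+ (2 * n)) + h * (2 * S2)) =
    - a * (S1 - S2) + (2 * h - a) * S2 by ring.
rewrite rpredD ?(dvdz_mulr _ ha) // dvdz_mull // /S1 /S2 -sumrB.
rewrite big_nat rpred_sum // => k /andP[k_gt0 k_le].
rewrite -mulrBr dvdz_mull // -mulnBr IHn //.
by rewrite ltn_subrL k_gt0.
Qed.

(** * The indicator of the integers prime to 3 *)

Definition coprime3 (x : int) : int := (~~ (3 %| x)%Z)%:R.

(** Exactly one of x - 1, x, x + 1 is a multiple of 3, so the three values sum to 2. *)
Lemma delta2_coprime3 (x : int) :
  delta2 coprime3 x = 2 * 1 + (- 3) * coprime3 x.
Proof.
rewrite /delta2 /coprime3.
case: (boolP (3 %| x)%Z); case: (boolP (3 %| x + 1)%Z);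
  case: (boolP (3 %| x - 1)%Z) => * //; lia.
Qed.

Lemma resolvent0_coprime3 (h : int) (K : nat) : (3 %| h)%Z ->
  (3 ^+ K %| (1 - 3 * h) * resolvent0 h K coprime3 + 2 * h)%Z.
Proof.
move=> h3; have := resolvent0_eqmod h K coprime3 h3.
rewrite (resolvent0_lin _ _ _ _ (fun=> 1) _ _ delta2_coprime3).
have := resolvent0_eqmod h K (fun=> 1) h3.
rewrite (resolvent0_sum _ _ 'I_0 [::] (fun=> 0) (fun=> id) (delta2 _));
  last by move=> x; rewrite /delta2 big_nil.
rewrite big_nil mulr0 addr0 /coprime3 dvdz0 subr0.
set L1 := resolvent0 h K _; set L := resolvent0 h K _ => L1_1 L_eq.
have -> : (1 - 3 * h) * L + 2 * h =
    L + h * (2 * L1 + -3 * L) - 2 * h * (L1 - 1) by ring.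
by rewrite rpredB // dvdz_mull.
Qed.

(** * Powers modulo powers of 3 *)

(** Cubing 1 + 3^(k+1) q gains one factor 3. *)
Lemma expr_sub1_dvd3 (y : int) (k m : nat) :
  (3 %| y - 1)%Z -> (3 ^+ k.+1 %| y ^+ (3 ^ k * m) - 1)%Z.
Proof.
move=> y1; rewrite mulnC exprM; set z := y ^+ m.
have z1 : (3 %| z - 1)%Z by rewrite /z subrX1 dvdz_mulr.
elim: k => [|k /dvdzP[q Hq]]; first by rewrite expr1.
rewrite expnS mulnC exprM; apply/dvdzP.
have -> : z ^+ (3 ^ k) = 1 + q * (3 * 3 ^+ k) by rewrite -exprS -Hq; ring.
exists (q + q ^+ 2 * 3 * 3 ^+ k + q ^+ 3 * 3 ^+ k * 3 * 3 ^+ k).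
by rewrite !exprS; ring.
Qed.

(** Cubing passes from k to k + 1; the case k = 0 is an induction on m modulo 27. *)
Lemma expr4_sub1_eqmod (k m n : nat) : n = (3 ^ k * m)%N ->
  (3 ^+ k.+3 %| 4 ^+ n - 1 - 6 * n%:R * (3 * n%:R ^+ 2 + 3 * n%:R - 1))%Z.
Proof.
elim: k n => [|k IHk] n ->.
  rewrite expn0 mul1n; elim: m => [|m /dvdzP[q Hq]] //.
  apply/dvdzP; exists (4 * q + 2 * m%:R ^+ 3 - 4 * m%:R - 1).
  have -> : 4 ^+ m.+1 = 4 * (q * 3 ^+ 3 + 1 +
      6 * m%:R * (3 * m%:R ^+ 2 + 3 * m%:R - 1)) :> int.
    by rewrite exprS -Hq; ring.
  by rewrite -natr1; ring.
have /dvdzP[q Hq] := IHk _ erefl.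
rewrite expnSr mulnAC exprM; set n0 := (3 ^ k * m)%N in Hq *.
set M : int := m%:R; set P : int := 3 ^+ k.
have nE : n0%:R = P * M :> int by rewrite natrM natrX.
have -> : (n0 * 3)%:R = 3 * (P * M) :> int by rewrite natrM nE mulrC.
have -> : 4 ^+ n0 = q * (27 * P) + 1 +
    6 * (P * M) * (3 * (P * M) ^+ 2 + 3 * (P * M) - 1) :> int.
  have -> : q * (27 * P) = q * 3 ^+ k.+3 by rewrite !exprS /P; ring.
  by rewrite -Hq nE; ring.
have -> : 3 ^+ k.+4 = 81 * P :> int by rewrite !exprS /P; ring.
(* The first sum cubes to 1 + 18 X (27 X^2 + 9 X - 1) modulo 81 P: besides
   the terms in q, the excess 3 u^2 + u^3 + 18 X v - 18 X (27 X^2 + 9 X - 1)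
   equals 108 X^2 (v^2 - 1) + 216 X^3 (v^3 + 1) - 648 X^3, where
   v + 1 = 3 X (X + 1) and P | X. *)
set X := P * M; set v := 3 * X ^+ 2 + 3 * X - 1; set u := 6 * X * v.
apply/dvdzP; exists (q + 27 * P * q ^+ 2 + 2 * q * u
  + 4 * M * X ^+ 2 * (X + 1) * (3 * X ^+ 2 + 3 * X - 2)
  + 243 * P ^+ 2 * q ^+ 3 + 27 * P * q ^+ 2 * u + q * u ^+ 2
  + 8 * M * X ^+ 3 * (X + 1) * (v ^+ 2 - v + 1) - 8 * M * X ^+ 2).
by rewrite /u /v /X; ring.
Qed.

Lemma resolvent0_dvd3 (h : int) (k : nat) (g : int -> int) :
  (3 %| h)%Z -> (forall x, 3 ^+ k.+1 %| g x)%Z -> (3 ^+ k.+2 %| g 3)%Z ->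
  (forall x, g (- x) = g x) -> g 0 = 0 -> g 1 = 0 ->
  (3 ^+ (k + 5) %| resolvent0 h (k + 5) g - 2 * h ^+ 2 * g 2)%Z.
Proof.
move=> h3 g_dvd g3_dvd gN g0 g1; rewrite /resolvent0.
have h3X i : (3 ^+ i %| (- h) ^+ i)%Z by rewrite dvdz_exp2r // rpredN.
rewrite -(big_mkord xpredT (fun j => (- h) ^+ j * iter j delta2 g 0)).
have k5_ge4 : (4 <= k + 5)%N by lia.
rewrite (big_cat_nat _ k5_ge4) //=.
rewrite addrAC; apply: rpredD.
  have gN1 : g (-1) = 0 by rewrite gN.
  have gN2 : g (-2) = g 2 by rewrite gN.
  have gN3 : g (-3) = g 3 by rewrite gN.
  pose D x y z : int := x - 2 * y + z.
  have it1 : iter 1 delta2 g 0 = D (g 1) (g 0) (g (-1)) by [].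
  have it2 : iter 2 delta2 g 0 = D (D (g 2) (g 1) (g 0))
    (D (g 1) (g 0) (g (-1))) (D (g 0) (g (-1)) (g (-2))) by [].
  have it3 : iter 3 delta2 g 0 =
    D (D (D (g 3) (g 2) (g 1)) (D (g 2) (g 1) (g 0)) (D (g 1) (g 0) (g (-1))))
      (D (D (g 2) (g 1) (g 0)) (D (g 1) (g 0) (g (-1)))
         (D (g 0) (g (-1)) (g (-2))))
      (D (D (g 1) (g 0) (g (-1))) (D (g 0) (g (-1)) (g (-2)))
         (D (g (-1)) (g (-2)) (g (-3)))) by [].
  rewrite !big_nat_recr // big_geq // it1 it2 it3 gN1 gN2 gN3 g0 g1 /= g0.
  set S := (S in (_ %| S)%Z).
  have -> : S = (- h) ^+ 3 * (2 * (g 3 - 2 * (3 * g 2))) by rewrite /S /D; ring.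
  (* The cube of [- h] contributes 3^3; both [g 3] and [3 * g 2] are multiples of 3^(k+2). *)
  rewrite (_ : (k + 5 = 3 + k.+2)%N) ?exprD; last by lia.
  rewrite dvdz_mul // dvdz_mull // rpredB // dvdz_mull //.
  by rewrite exprS dvdz_mul.
rewrite big_nat rpred_sum // => j /andP[j_ge4 _].
(* The power of [- h] contributes 3^4 and the iterated difference 3^(k+1). *)
rewrite -(subnKC j_ge4) exprD -mulrA.
rewrite (_ : (k + 5 = 4 + k.+1)%N) ?exprD; last by lia.
by rewrite dvdz_mul // dvdz_mull // dvdz_iter_delta2.
Qed.

(** If 3 divides x, the exponent exceeds k; otherwise x^2 is 1 modulo 3 and repeated cubing
    applies. *)
Lemma expr_even_sub_coprime3_dvd (k m : nat) (x : int) : (0 < m)%N ->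
  (3 ^+ k.+1 %| x ^+ (2 * (3 ^ k * m)) - coprime3 x)%Z.
Proof.
move=> m_gt0; have k_lt : (k < 3 ^ k * m)%N.
  by rewrite (leq_trans (ltn_expl k (isT : 1 < 3)%N)) // leq_pmulr.
rewrite /coprime3; case: (boolP (3 %| x)%Z) => [x3|x3] /=.
  rewrite subr0 (dvdz_trans (dvdz_exp2l _ (_ : k.+1 <= 2 * (3 ^ k * m))%N)) //.
    by rewrite (leq_trans k_lt) // leq_pmull.
  by rewrite dvdz_exp2r.
rewrite exprM expr_sub1_dvd3 // expr2.
have -> : x * x - 1 = (x - 1) * (x + 1) by ring.
have [x1|x1] : (3 %| x - 1)%Z \/ (3 %| x + 1)%Z by lia.
  by rewrite dvdz_mulr.
by rewrite dvdz_mull.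
Qed.

(** * The congruence over the integers, with denominator cleared *)

Lemma Eseq_eqmod3 (a : int) (n : nat) : (3 %| a)%Z -> (0 < n)%N ->
  (3 ^+ (logn 3 n + 5) %| (3 * a - 2) * Eseq a (2 * n) -
     (2 * a + (3 * a - 2) *
        (3 * a ^+ 2 * n%:R * (3 * n%:R ^+ 2 + 3 * n%:R - 1))))%Z.
Proof.
move=> a3 n_gt0; set k := logn 3 n.
have [m nE] : exists m, n = (3 ^ k * m)%N.
  by have /dvdnP[m ->] := pfactor_dvdnn 3 n; exists m; rewrite mulnC.
have m_gt0 : (0 < m)%N by move: n_gt0; rewrite nE muln_gt0 => /andP[].
(* Half of the even number 1 + 3^(k+5) is an inverse of 2 modulo 3^(k+5). *)
have [e eE] : exists e : int, 2 * e = 1 + 3 ^+ (k + 5).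
  elim: (k + 5)%N => [|i [e eE]]; first by exists 1.
  by exists (3 * e - 1); rewrite exprS mulrBr mulrCA eE; ring.
have h3 : (3 %| a * e)%Z by rewrite dvdz_mulr.
(* h represents a / 2 modulo d. *)
set h := a * e in h3; set d := 3 ^+ (k + 5) in eE *.
have hE : (d %| 2 * h - a)%Z.
  have -> : 2 * h - a = a * (2 * e - 1) by rewrite /h; ring.
  by rewrite eE (addrC 1) addrK dvdz_mull.
set g := fun x => x ^+ (2 * n) - coprime3 x.
have g_dvd x : (3 ^+ k.+1 %| g x)%Z by rewrite /g nE expr_even_sub_coprime3_dvd.
have k_lt : (k < n)%N by rewrite ltn_logl.
have h_g : (d %| resolvent0 h (k + 5) g - 2 * h ^+ 2 * (4 ^+ n - 1))%Z.
  have -> : 4 ^+ n - 1 = g 2 by rewrite /g exprM.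
  apply: resolvent0_dvd3 => //.
  (* Here [g 3] is 3^(2n), and k < n gives k + 2 <= 2n. *)
  - by rewrite /g subr0 dvdz_exp2l //; lia.
  - by move=> x; rewrite /g exprM sqrrN -exprM /coprime3 rpredN.
  - by rewrite /g expr0n muln_eq0 /= gtn_eqF.
  - by rewrite /g expr1n.
have h_E := Eseq_resolvent0 h (k + 5) a n h3 hE.
rewrite (resolvent0_lin _ _ 1 1 coprime3 g) in h_E; last first.
  by move=> x; rewrite /g; ring.
have h_c := resolvent0_coprime3 h (k + 5) h3.
have h_4 : (d %| 2 * h ^+ 2 *
    (4 ^+ n - 1 - 6 * n%:R * (3 * n%:R ^+ 2 + 3 * n%:R - 1)))%Z.
  (* Two of the k + 5 factors 3 come from [h ^+ 2], the others from the congruence for 4^n. *)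
  rewrite /d -[(k + 5)%N]/(k + (2 + 3))%N addnCA exprD dvdz_mul //.
    by rewrite dvdz_mull // dvdz_exp2r.
  by have := expr4_sub1_eqmod k m n nE; rewrite addn3.
move: h_g h_E h_c h_4; rewrite -/d.
set Lg := resolvent0 _ _ g; set Lc := resolvent0 _ _ coprime3.
set F := 4 ^+ n; set N := n%:R; set E := Eseq a _ => h_g h_E h_c h_4.
(* Each summand has a factor known to be divisible by [d]; the multiple of [2 * h - a] pays for
   replacing 2h by a. *)
have -> : (3 * a - 2) * E - (2 * a + (3 * a - 2) *
      (3 * a ^+ 2 * N * (3 * N ^+ 2 + 3 * N - 1))) =
    (3 * a - 2) * (E - (1 * Lc + 1 * Lg))
    + (3 * a - 2) * (Lg - 2 * h ^+ 2 * (F - 1))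
    - 2 * ((1 - 3 * h) * Lc + 2 * h)
    + (2 - 3 * Lc + (3 * a - 2) * (3 * N * (3 * N ^+ 2 + 3 * N - 1)
         * (2 * h + a))) * (2 * h - a)
    + (3 * a - 2) * (2 * h ^+ 2 *
         (F - 1 - 6 * N * (3 * N ^+ 2 + 3 * N - 1))) by ring.
apply: rpredD; last exact: dvdz_mull.
apply: rpredD; last exact: dvdz_mull.
apply: rpredB; last exact: dvdz_mull.
by apply: rpredD; apply: dvdz_mull.
Qed.

(** * Passage to the rationals *)

Lemma Eseq_intr (R : nzRingType) (a : int) (n : nat) :
  Eseq (a%:~R : R) n = (Eseq a n)%:~R.
Proof.
elim/ltn_ind: n => -[|n] IHn; first by rewrite !Eseq0.
rewrite !Eseq_rec // rmorphM rmorphN rmorph_sum; congr (_ * _).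
apply: eq_big_nat => k /andP[k_gt0 _]; rewrite rmorphM rmorph_nat IHn //.
by lia.
Qed.

(** The reduced denominator is prime to the numerator, hence divides [D]. *)
Lemma p_integral_frac (p : nat) (m D : int) : D != 0 -> coprime p `|D| ->
  p_integral p (m%:~R / D%:~R).
Proof.
move=> D0 pD; rewrite /p_integral; apply: coprime_dvdr pD.
set x := _ / _; have xE : x * D%:~R = m%:~R by rewrite divfK // intr_eq0.
have /intr_inj eq_int : (numq x * D)%:~R = (m * denq x)%:~R :> rat.
  by rewrite !intrM -xE numqE; ring.
have : (denq x %| numq x * D)%Z by rewrite eq_int dvdz_mull.
by rewrite Gauss_dvdzr // coprimezE coprime_sym coprime_num_den.
Qed.

Theorem theorem4p1 (a : int) (n : nat)
    (ha0 : a != 0) (ha3 : (3 %| a)%Z) (hn : (2 <= n)%N) :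
  let A : rat := a%:~R in
  let N : rat := n%:R in
  rat_congr 3 (logn 3 n + 5)
    (Eseq A (2 * n))
    (2 * A / (3 * A - 2) + 9 * A ^+ 2 * N ^+ 3 + 9 * A ^+ 2 * N ^+ 2
       - 3 * A ^+ 2 * N).
Proof.
move=> A N.
have /dvdzP[q Eq] := Eseq_eqmod3 a n ha3 (ltnW hn).
have D0 : 3 * a - 2 != 0 by lia.
have D3 : coprime 3 `|(3 * a - 2)%R| by rewrite prime_coprime //; lia.
have DE : (3 * a - 2)%:~R = 3 * A - 2 :> rat by rewrite rmorphB rmorphM.
have DA0 : 3 * A - 2 != 0 by rewrite -DE intr_eq0.
set y := (Y in rat_congr _ _ _ Y).
have yE : y = (2 * a + (3 * a - 2) *
    (3 * a ^+ 2 * n%:R * (3 * n%:R ^+ 2 + 3 * n%:R - 1)))%:~R / (3 * a - 2)%:~R.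
  rewrite DE /y !(rmorphD, rmorphB, rmorphM, rmorphXn, rmorph_nat) /= -/A -/N.
  by field.
rewrite Eseq_intr; split.
- by rewrite /p_integral denq_int coprimen1.
- by rewrite yE p_integral_frac.
exists (q%:~R / (3 * a - 2)%:~R); first by rewrite p_integral_frac.
have := congr1 (fun z : int => z%:~R : rat) Eq.
rewrite /= yE rmorphB !rmorphM /= !DE.
rewrite rmorphXn /= => Eq_rat; apply: (mulfI DA0).
by rewrite mulrBr [in LHS]mulrCA divff // mulr1 Eq_rat; field.
Qed.
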